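(* Let $\lambda>0$ and let $Y_1, Y_2, \ldots$ be i.i.d. random variables with the Poisson$(\lambda)$ distribution. Let $(\nu_{\max}(n))_{n\ge1}$ be a sequence of positive real numbers such that $\nu_{\max}(n)\to\infty$ as $n\to\infty$. Let $(\hat\nu_n,\hat p_n)$ denote the maximum likelihood estimate of $(\nu,p)$ for a negative binomial distribution NB$(\nu,p)$, based on $Y_1,\ldots,Y_n$, under the constraint $0<\nu\le\nu_{\max}(n)$ (and $p\in(0,1]$). Then, with probability $1$, $\hat\nu_n\to\infty$ as $n\to\infty$.
   Context: Poisson$(\lambda)$ has probability mass function $f_\lambda(y)=\frac{\lambda^y}{y!}e^{-\lambda}$, $y=0,1,2,\ldots$. For $\nu>0$ and $p\in(0,1)$, NB$(\nu,p)$ is the distribution on $\{0,1,2,\ldots\}$ with probability mass function $$f_{(\nu,p)}(y)=\frac{\Gamma(\nu+y)}{\Gamma(\nu)\Gamma(y+1)}\,p^\nu(1-p)^y .$$ For $p=1$ (any $\nu>0$) the distribution is the degenerate one putting mass $1$ at $0$. Given data $Y_1,\ldots,Y_n$, a maximum likelihood estimate (MLE) of $(\nu,p)$ under the constraint $0<\nu\le\nu_{\max}(n)$ is a maximizer of $\prod_{i=1}^n f_{(\nu,p)}(Y_i)$ over $(\nu,p)\in(0,\nu_{\max}(n)]\times(0,1]$. *)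

(* Defs.v *)
From HB Require Import structures.
From mathcomp Require Import all_boot all_order all_algebra finmap.
From mathcomp Require Import all_classical all_reals all_analysis.

Set Implicit Arguments.
Unset Strict Implicit.
Unset Printing Implicit Defensive.

Import Order.TTheory GRing.Theory Num.Theory.
Import numFieldNormedType.Exports.

Local Open Scope classical_set_scope.
Local Open Scope ring_scope.

Definition mutually_independent {d d'} {T : measurableType d}
    {T' : measurableType d'} {R : realType} (P : probability T R)
    {I : choiceType} (X : I -> {RV P >-> T'}) : Prop :=
  forall (J : {fset I}) (A : I -> set T'),
    (forall i, i \in J -> measurable (A i)) ->
    P (\bigcap_(i in [set` J]) (X i @^-1` A i)) =
    (\prod_(i <- J) P (X i @^-1` A i))%E.

Definition gamma_fun {R : realType} (x : R) : R :=
  \int[lebesgue_measure]_(t in `]0, +oo[) (t `^ (x - 1) * expR (- t)).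

Definition nb_pmf {R : realType} (nu p : R) (y : nat) : R :=
  if p == 1 then (y == 0%N)%:R
  else gamma_fun (nu + y%:R) / (gamma_fun nu * gamma_fun (y%:R + 1))
       * p `^ nu * (1 - p) ^+ y.

(* The sample is [y 0, ..., y (n - 1)]. *)
Definition nb_likelihood {R : realType} (n : nat) (y : nat -> nat)
    (nu p : R) : R :=
  \prod_(i < n) nb_pmf nu p (y i).

(* Maximizers need not be unique (if all observations are 0, every [nu]
   together with [p = 1] is one), hence a predicate rather than a function. *)
Definition is_nb_mle {R : realType} (numax : R) (n : nat) (y : nat -> nat)
    (nu p : R) : Prop :=
  [/\ 0 < nu <= numax, 0 < p <= 1 &
      forall nu' p', 0 < nu' <= numax -> 0 < p' <= 1 ->
        nb_likelihood n y nu' p' <= nb_likelihood n y nu p].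

(* Main.v *)
Require Import Defs.
From HB Require Import structures.
From mathcomp Require Import all_boot all_order all_algebra finmap.
From mathcomp Require Import all_classical all_reals all_analysis.
From mathcomp Require Import measurable_realfun.
From mathcomp Require Import ring lra.

Set Implicit Arguments.
Unset Strict Implicit.
Unset Printing Implicit Defensive.

Import Order.TTheory GRing.Theory Num.Theory.
Import numFieldNormedType.Exports.

Local Open Scope classical_set_scope.
Local Open Scope ring_scope.

(** For fixed [nu], the likelihood is maximal at [p = nu / (nu + m)], [m] being
    the sample mean. The derivative in [nu] of the logarithm of the resulting
    profile likelihood, divided by [n], is
      [sum_j S_j / (nu + j) - ln (1 + m / nu)],
    where [S_j] is the proportion of observations larger than [j]. Its limit
    [phi lambda := sum_j P(Y > j) / (nu + j) - ln (1 + lambda / nu)] is positive: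
    [phi 0 = 0], and since [d P(Y > j) / d lambda = P(Y = j)],
    [phi' lambda = E (1 / (nu + Y)) - 1 / (nu + lambda) > 0] by Jensen.
    With an explicit lower bound on the gap in Jensen's inequality, [nu * phi] is
    bounded away from 0 uniformly in [nu <= K], even with the sum over [j]
    truncated. So only finitely many frequencies and the sample mean have to be
    close to their limits for the profile likelihood to increase on [(0, K]],
    which pushes the estimate above [K]. *)

(** * The score inequality for the Poisson law *)

Section mean_value.
Context {R : realType}.
Implicit Types (f df : R -> R) (a b : R).

Lemma is_derive_within_continuous f df a b :
  (forall x, a <= x <= b -> is_derive x 1 f (df x)) ->
  {within `[a, b], continuous f}.
Proof.
move=> fdf; apply: derivable_within_continuous => x.
by rewrite in_itv/= => /fdf[].
Qed.

Lemma is_derive_ge0_le f df a b : a <= b ->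
  (forall x, a <= x <= b -> is_derive x 1 f (df x)) ->
  (forall x, a <= x <= b -> 0 <= df x) -> f a <= f b.
Proof.
move=> ab fdf df0.
have [||c] := @MVT_segment R f df a b ab.
- by move=> x; rewrite in_itv/= => /andP[ax xb]; apply: fdf; rewrite !ltW.
- exact: is_derive_within_continuous fdf.
by rewrite in_itv/= => cab E; rewrite -subr_ge0 E mulr_ge0 ?df0 ?subr_ge0.
Qed.

Lemma is_derive_gt0_lt f df a b : a < b ->
  (forall x, a <= x <= b -> is_derive x 1 f (df x)) ->
  (forall x, a < x < b -> 0 < df x) -> f a < f b.
Proof.
move=> ab fdf df0.
have [||c] := @MVT R f df a b ab.
- by move=> x; rewrite in_itv/= => /andP[ax xb]; apply: fdf; rewrite !ltW.
- exact: is_derive_within_continuous fdf.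
by rewrite in_itv/= => cab E; rewrite -subr_gt0 E mulr_gt0 ?df0 ?subr_gt0.
Qed.

Lemma is_derive_fsum (n : nat) (h : nat -> R -> R) (dh : nat -> R) (x : R) :
  (forall i, (i < n)%N -> is_derive x 1 (h i) (dh i)) ->
  is_derive x 1 (fun t => \sum_(i < n) h i t) (\sum_(i < n) dh i).
Proof.
move=> H; have := @is_derive_sum R R R n (fun i => h i) x 1 (fun i => dh i)
  (fun i => H i (ltn_ord i)).
by congr is_derive; apply/funext => t; rewrite fct_sumE.
Qed.

Lemma is_derive_exprn n (x : R) :
  is_derive x 1 (fun t => t ^+ n) (n%:R * x ^+ n.-1).
Proof.
have := is_deriveX n (is_derive_id x 1).
rewrite /GRing.scale/= mulr1.
by congr is_derive; apply/funext => t; rewrite exprfctE.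
Qed.

Lemma is_derive_expRN (x : R) :
  is_derive x 1 (fun t => expR (- t)) (- expR (- x)).
Proof. by rewrite -mulrN1; apply: is_derive1_comp; exact: is_deriveNid. Qed.

Lemma is_derive_lnD (c x : R) : 0 < c + x ->
  is_derive x 1 (fun t => ln (c + t)) (c + x)^-1.
Proof.
move=> cx.
have H1 : is_derive x 1 (fun t => c + t) (0 + 1).
  exact: (is_deriveD (is_derive_cst c x 1) (is_derive_id x 1)).
have H2 := is_derive1_ln cx.
have := is_derive1_comp H2 H1.
by rewrite add0r mulr1.
Qed.

End mean_value.

(** * Poisson probabilities as functions of the parameter *)

Section poisson_cdf.
Context {R : realType}.
Implicit Types (l nu K m : R).

(** Unlike in [poisson_pmf], the formula makes no case distinction on the sign of [l], so it can be
    differentiated at [l = 0]. *)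
Definition pois l (k : nat) : R := l ^+ k / k`!%:R * expR (- l).

Definition pois_cdf l (j : nat) : R := \sum_(k < j.+1) pois l k.

Lemma pois_ge0 l k : 0 <= l -> 0 <= pois l k.
Proof. by move=> l0; rewrite !mulr_ge0 ?exprn_ge0 ?invr_ge0 ?expR_ge0. Qed.

Lemma pois0 l : pois l 0 = expR (- l).
Proof. by rewrite /pois expr0 fact0 divr1 mul1r. Qed.

Lemma poisS l k : k.+1%:R * pois l k.+1 = l * pois l k.
Proof.
rewrite /pois factS exprS natrM.
field.
by rewrite nat1r !pnatr_eq0 -!lt0n fact_gt0.
Qed.

Lemma pois_cdfS l j : pois_cdf l j.+1 = pois_cdf l j + pois l j.+1.
Proof. by rewrite /pois_cdf big_ord_recr. Qed.

Lemma is_derive_poisS l k :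
  is_derive l 1 (pois ^~ k.+1) (pois l k - pois l k.+1).
Proof.
have E2 : is_derive l 1 (fun t : R => t ^+ k.+1) (k.+1%:R * l ^+ k).
  exact: (is_derive_exprn k.+1).
have := is_deriveM (is_deriveM E2 (is_derive_cst (k.+1`!%:R^-1 : R) l 1))
  (is_derive_expRN l).
have -> : pois ^~ k.+1 =
  ((fun t : R => t ^+ k.+1) * cst k.+1`!%:R^-1) * (fun t : R => expR (- t)).
  by apply/funext.
move=> /is_derive_eq; apply.
rewrite /pois factS natrM /GRing.scale/= !mulrfctE /cst exprS.
field.
by rewrite nat1r !pnatr_eq0 -!lt0n fact_gt0.
Qed.

(** The derivatives [pois l k - pois l k.+1] telescope. *)
Lemma is_derive_pois_cdf l j : is_derive l 1 (pois_cdf ^~ j) (- pois l j).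
Proof.
elim: j => [|j IH].
  have -> : pois_cdf ^~ 0 = (fun t : R => expR (- t)).
    by apply/funext => t; rewrite /pois_cdf big_ord1 pois0.
  by rewrite pois0; exact: is_derive_expRN.
have := is_deriveD IH (is_derive_poisS l j).
have -> : pois_cdf ^~ j.+1 = pois_cdf ^~ j + pois ^~ j.+1.
  by apply/funext => t; rewrite pois_cdfS.
by move=> /is_derive_eq; apply; ring.
Qed.

Lemma pois_cdf_nincr l l' j : 0 <= l -> l <= l' ->
  pois_cdf l' j <= pois_cdf l j.
Proof.
move=> l0 ll'; rewrite -lerN2.
apply: (@is_derive_ge0_le R (fun t => - pois_cdf t j)
  (fun t => - - pois t j)) => //.
  by move=> x _; apply: is_deriveN; exact: is_derive_pois_cdf.
by move=> x /andP[lx _]; rewrite opprK pois_ge0// (le_trans l0).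
Qed.

Lemma pois_cdf0 j : pois_cdf 0 j = 1.
Proof.
rewrite /pois_cdf big_ord_recl pois0 oppr0 expR0 big1 ?addr0// => i _.
by rewrite /pois expr0n/= !mul0r.
Qed.

Lemma pois_cdf_le1 l j : 0 <= l -> pois_cdf l j <= 1.
Proof. by move=> l0; rewrite -(pois_cdf0 j) pois_cdf_nincr. Qed.

Lemma cvg_pois_cdf l : pois_cdf l j @[j --> \oo] --> (1 : R).
Proof.
have -> : (1 : R) = expR l * expR (- l) by rewrite -expRD subrr expR0.
have -> : pois_cdf l = fun j => series (exp_coeff l) j.+1 * expR (- l).
  apply/funext => j; rewrite /pois_cdf /series/= big_mkord mulr_suml.
  by apply: eq_bigr => k _; rewrite /pois /exp_coeff.
apply: cvgMr_tmp.
have /= := @is_cvg_series_exp_coeff R l.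
by rewrite -(cvg_shiftS (series (exp_coeff l))).
Qed.

Lemma sum_pois_centered l n :
  \sum_(j < n.+1) pois l j * (l - j%:R) = l * pois l n.
Proof.
elim: n => [|n IH]; first by rewrite big_ord1 subr0 mulrC.
rewrite big_ord_recr/= IH -poisS; ring.
Qed.

(* The tangent line at [l] of the convex function [x |-> nu / (nu + x)], with
   its remainder kept at [x = 0]. *)
Lemma sum_pois_jensen l nu n : 0 <= l -> 0 < nu ->
  nu / (nu + l) * pois_cdf l n + expR (- l) * l ^+ 2 / (nu + l) ^+ 2 <=
  \sum_(j < n.+1) pois l j * (nu / (nu + j%:R)).
Proof.
move=> l0 nu0.
have nul : 0 < nu + l by rewrite ltr_wpDr.
pose a := nu / (nu + l); pose b := nu / (nu + l) ^+ 2.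
have b0 : 0 <= b by rewrite divr_ge0 ?exprn_ge0 ?ltW.
have tang (j : nat) : a + b * (l - j%:R) <= nu / (nu + j%:R).
  have nuj : 0 < nu + j%:R by rewrite ltr_wpDr.
  rewrite -subr_ge0.
  have -> : nu / (nu + j%:R) - (a + b * (l - j%:R)) =
            b * (l - j%:R) ^+ 2 / (nu + j%:R).
    by rewrite /a /b; field; rewrite !gt_eqF.
  exact: divr_ge0 (mulr_ge0 b0 (sqr_ge0 _)) (ltW nuj).
(* The remainder [b * l ^+ 2 / nu] at [j = 0] no longer has [nu] in its numerator, so it does not
   degenerate as [nu] tends to 0. *)
have tang0 : nu / (nu + 0%:R) = a + b * (l - 0%:R) + l ^+ 2 / (nu + l) ^+ 2.
  by rewrite /a /b; field; rewrite !gt_eqF.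
apply: (@le_trans _ _ (\sum_(j < n.+1) (pois l j * (a + b * (l - j%:R))) +
   expR (- l) * l ^+ 2 / (nu + l) ^+ 2)).
  rewrite lerD2r.
  under eq_bigr do rewrite mulrDr [pois _ _ * (b * _)]mulrCA.
  rewrite big_split/= -mulr_suml -mulr_sumr sum_pois_centered -/(pois_cdf l n).
  rewrite mulrC lerDl; exact: mulr_ge0 b0 (mulr_ge0 l0 (pois_ge0 n l0)).
rewrite big_ord_recl [leRHS]big_ord_recl/= tang0.
rewrite [X in _ <= X + _]mulrDr [in X in _ <= _ + X + _]pois0 mulrA.
rewrite [leLHS]addrAC lerD2l.
by apply: ler_sum => j _; rewrite ler_wpM2l ?pois_ge0.
Qed.

(* [H], as a function of the Poisson parameter [x], vanishes at 0 and has a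
   nonnegative derivative; the term [t * x] pays for the truncation at [n]. *)
Lemma pois_score_gap l K nu n : 0 < l -> 0 < nu <= K ->
  expR (- l) * l ^+ 3 / (3 * (K + l) ^+ 2) - (1 - pois_cdf l n) * l <=
  nu * (\sum_(j < n.+1) (1 - pois_cdf l j) / (nu + j%:R)
        - (ln (nu + l) - ln nu)).
Proof.
move=> l0 /andP[nu0 nuK].
have K0 : 0 < K by apply: lt_le_trans nuK.
(* For [x <= l] and [nu <= K], [c] is a lower bound of [expR (- x) / (nu + x) ^+ 2]; the primitive
   of [c * x ^+ 2] is the last term of [H]. *)
set t := 1 - pois_cdf l n; pose c := expR (- l) / (K + l) ^+ 2.
pose H x := \sum_(j < n.+1) (1 - pois_cdf x j) * (nu / (nu + j%:R))
  - nu * (ln (nu + x) - ln nu) + t * x - c / 3 * x ^+ 3.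
pose dH x := \sum_(j < n.+1) pois x j * (nu / (nu + j%:R))
  - nu * (nu + x)^-1 + t - c * x ^+ 2.
have H0 : H 0 = 0.
  rewrite /H big1; last by move=> j _; rewrite pois_cdf0 subrr mul0r.
  by rewrite addr0 subrr expr0n/= !mulr0 !subr0 addr0.
have dHE x : 0 <= x <= l -> is_derive x 1 H (dH x).
  move=> /andP[x0 xl].
  have D1 : is_derive x 1
      (fun x => \sum_(j < n.+1) (1 - pois_cdf x j) * (nu / (nu + j%:R)))
      (\sum_(j < n.+1) pois x j * (nu / (nu + j%:R))).
    apply: (@is_derive_fsum _ n.+1
      (fun j x => (1 - pois_cdf x j) * (nu / (nu + j%:R)))
      (fun j => pois x j * (nu / (nu + j%:R)))) => j _.
    have := is_deriveM (is_deriveB (is_derive_cst (1 : R) x 1)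
      (is_derive_pois_cdf x j)) (is_derive_cst (nu / (nu + j%:R) : R) x 1).
    move=> /is_derive_eq; apply; rewrite scaler0 add0r sub0r opprK /GRing.scale/=.
    by rewrite mulrC.
  have nux : 0 < nu + x by rewrite ltr_wpDr.
  have D2 : is_derive x 1 (fun x => nu * (ln (nu + x) - ln nu))
      (nu * (nu + x)^-1).
    have := is_deriveZ nu (is_deriveB (is_derive_lnD nux)
      (is_derive_cst (ln nu) x 1)).
    by move=> /is_derive_eq; apply; rewrite subr0.
  have D3 : is_derive x 1 (fun x => t * x) t.
    have := is_deriveZ t (is_derive_id x 1).
    by move=> /is_derive_eq; apply; rewrite /GRing.scale/= mulr1.
  have D4 : is_derive x 1 (fun x => c / 3 * x ^+ 3) (c * x ^+ 2).
    have := is_deriveZ (c / 3) (is_derive_exprn 3 x).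
    by move=> /is_derive_eq; apply; rewrite /GRing.scale/=; field.
  exact: is_deriveB (is_deriveD (is_deriveB D1 D2) D3) D4.
have dH0 x : 0 <= x <= l -> 0 <= dH x.
  move=> /andP[x0 xl]; rewrite /dH.
  have nux : 0 < nu + x by rewrite ltr_wpDr.
  have J := sum_pois_jensen n x0 nu0.
  have P1 := pois_cdf_nincr n x0 xl.
  have a1 : nu / (nu + x) <= 1 by rewrite ler_pdivrMr// mul1r lerDl.
  have a0 : 0 <= nu / (nu + x) by rewrite divr_ge0 ?ltW.
  have t0 : 0 <= t by rewrite subr_ge0 pois_cdf_le1// ltW.
  have c1 : c * x ^+ 2 <= expR (- x) * x ^+ 2 / (nu + x) ^+ 2.
    rewrite /c mulrAC ler_pM//.
    - by rewrite mulr_ge0 ?expR_ge0 ?sqr_ge0.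
    - by rewrite invr_ge0 sqr_ge0.
    - by rewrite ler_wpM2r ?sqr_ge0// ler_expR lerN2.
    - rewrite lef_pV2 ?posrE ?exprn_gt0//; last by rewrite addr_gt0.
      by rewrite lerXn2r ?nnegrE ?addr_ge0 ?(ltW l0) ?(ltW nu0) ?(ltW K0)// lerD.
  (* Since [pois_cdf x n >= 1 - t], truncation costs at most [nu / (nu + x) * t <= t] in the Jensen
     bound. *)
  have : nu / (nu + x) * (1 - t) <= nu / (nu + x) * pois_cdf x n.
    by rewrite ler_wpM2l// /t opprB addrC subrK.
  have : nu / (nu + x) * t <= t by rewrite ler_piMl.
  lra.
have := is_derive_ge0_le (ltW l0) dHE dH0; rewrite H0 /H mulrBr.
have -> : \sum_(j < n.+1) (1 - pois_cdf l j) * (nu / (nu + j%:R)) =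
   nu * \sum_(j < n.+1) (1 - pois_cdf l j) / (nu + j%:R).
  by rewrite mulr_sumr; apply: eq_bigr => j _; rewrite mulrCA.
have -> : expR (- l) * l ^+ 3 / (3 * (K + l) ^+ 2) = c / 3 * l ^+ 3.
  by rewrite /c; field; rewrite gt_eqF// addr_gt0.
lra.
Qed.

(** The gap [c] does not depend on [nu], which leaves room for errors. After multiplication by [nu],
    truncation at [n] costs at most [c / 2], and an error [e] in each of the [n.+1] tails and in the
    mean costs at most [n.+2%:R * e = c / 4]. *)
Lemma pois_score_gt0 l K : 0 < l -> 0 < K ->
  exists (n : nat) (e : R), 0 < e /\ forall nu m, 0 < nu <= K -> 0 <= m ->
    m <= l + e ->
    ln (nu + m) - ln nu <
    \sum_(j < n.+1) (1 - pois_cdf l j - e) / (nu + j%:R).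
Proof.
move=> l0 K0.
set c := expR (- l) * l ^+ 3 / (3 * (K + l) ^+ 2).
have c0 : 0 < c.
  apply: divr_gt0; first exact: mulr_gt0 (expR_gt0 _) (exprn_gt0 _ l0).
  by apply: mulr_gt0 => //; exact: exprn_gt0 (addr_gt0 K0 l0).
have [n tn] : exists n, (1 - pois_cdf l n) * l <= c / 2.
  have /cvgrPdist_le/(_ (c / 2 / l)) := @cvg_pois_cdf l.
  have cl : 0 < c / 2 / l by do 2!apply: divr_gt0 => //.
  move=> /(_ cl)[n _ /(_ n (leqnn n))/= h]; exists n.
  by rewrite -ler_pdivlMr//; apply: le_trans h; rewrite ler_norm.
exists n; exists (c / 4 / n.+2%:R).
set e := c / 4 / n.+2%:R.
have e0 : 0 < e by do 2!apply: divr_gt0 => //.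
split=> // nu m nuK m0 ml; have /andP[nu0 _] := nuK.
have gap := pois_score_gap n l0 nuK; rewrite -/c in gap.
have nul : 0 < nu + l by rewrite addr_gt0.
have num : 0 < nu + m by rewrite ltr_wpDr.
rewrite -(ltr_pM2l nu0).
(* By [ln (1 + x) <= x], the cost is at most [nu * (m - l) / (nu + l) <= e]. *)
have lnm : nu * ln (nu + m) <= nu * ln (nu + l) + e.
  have -> : ln (nu + m) = ln ((nu + m) / (nu + l)) + ln (nu + l).
    by rewrite ln_div ?posrE// subrK.
  rewrite mulrDr addrC lerD2l.
  have -> : (nu + m) / (nu + l) = 1 + (m - l) / (nu + l).
    by field; rewrite gt_eqF.
  apply: (@le_trans _ _ (nu * ((m - l) / (nu + l)))).
    rewrite ler_pM2l// le_ln1Dx// ltr_pdivlMr// mulN1r; lra.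
  rewrite mulrCA; apply: (@le_trans _ _ (e * (nu / (nu + l)))).
    by rewrite ler_wpM2r ?(divr_ge0 (ltW nu0) (ltW nul))// lerBlDl.
  by rewrite ler_piMr// ?(ltW e0)// ler_pdivrMr// mul1r lerDl ltW.
have sume : nu * (\sum_(j < n.+1) (1 - pois_cdf l j) / (nu + j%:R)) - e *+ n.+1 <=
    nu * \sum_(j < n.+1) (1 - pois_cdf l j - e) / (nu + j%:R).
  rewrite -[X in e *+ X]card_ord -sumr_const !mulr_sumr -sumrB ler_sum// => j _.
  rewrite [X in _ <= nu * X]mulrBl mulrBr lerD2l lerN2 mulrCA ler_piMr ?(ltW e0)//.
  by rewrite ler_pdivrMr ?mul1r ?lerDl// ltr_wpDr.
have : e *+ n.+1 + e = c / 4.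
  by rewrite -mulrSr -(mulr_natr e) mulrC mulrCA mulfV ?pnatr_eq0// mulr1.
lra.
Qed.

End poisson_cdf.

(** * The gamma function *)

Section gamma_function.
Context {R : realType}.
Implicit Types (x t : R).
Local Notation mu := (@lebesgue_measure R).

Let g x t : R := t `^ (x - 1) * expR (- t).

(** In the extended reals the functional equation can be proved first and finiteness deduced from
    it. Finiteness is what makes [gamma_fun] positive, since [fine] sends infinity to 0. *)
Definition egamma x : \bar R := (\int[mu]_(t in `]0%R, +oo[) (g x t)%:E)%E.

Lemma gamma_funE x : gamma_fun x = fine (egamma x).
Proof. by []. Qed.

Lemma gamma_integrand_ge0 x t : 0 <= g x t.
Proof. by rewrite mulr_ge0 ?powR_ge0 ?expR_ge0. Qed.

Lemma measurable_gamma_integrand x (D : set R) : measurable_fun D (g x).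
Proof.
apply: measurable_funTS; apply: measurable_funM; first exact: measurable_powR.
exact: measurableT_comp.
Qed.

Lemma measurable_egamma_integrand x (D : set R) :
  measurable_fun D (fun t => (g x t)%:E).
Proof. by apply/measurable_EFinP; exact: measurable_gamma_integrand. Qed.

Lemma is_derive_derivable_oo_LRcontinuous (F f : R -> R) (a b : R) : a < b ->
  (forall t, a <= t <= b -> is_derive t 1 F (f t)) ->
  derivable_oo_LRcontinuous F a b.
Proof.
move=> ab Ff.
have cF t : a <= t <= b -> {for t, continuous F}.
  by move=> /Ff[dF _]; apply/differentiable_continuous/derivable1_diffP.
split.
- move=> t; rewrite in_itv/= => /andP[at_ tb].
  have /Ff[] : a <= t <= b by rewrite (ltW at_) (ltW tb).
  done.
- by apply: cvg_at_right_filter; apply: cF; rewrite lexx ltW.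
- by apply: cvg_at_left_filter; apply: cF; rewrite lexx ltW.
Qed.

(** The boundary terms are distributed so that no subtraction of extended reals occurs. *)
Lemma gamma_integral_by_parts x (a b : R) : 0 < a -> a < b ->
  (\int[mu]_(t in `[a, b]) (g (x + 1) t)%:E + (b `^ x * expR (- b))%:E =
   (a `^ x * expR (- a))%:E + x%:E * \int[mu]_(t in `[a, b]) (g x t)%:E)%E.
Proof.
move=> a0 ab.
pose F t : R := t `^ x; pose f t : R := x * t `^ (x - 1).
pose G t : R := - expR (- t); pose h t : R := expR (- t).
have Ff t : a <= t <= b -> is_derive t 1 F (f t).
  by move=> /andP[at_ _]; apply: is_derive1_powR; exact: lt_le_trans at_.
have hd t : is_derive t 1 h (- h t).
  exact: is_derive_expRN.
have Gh t : is_derive t 1 G (h t).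
  by have /is_derive_eq := is_deriveN (hd t); apply; rewrite opprK.
have ch (u : R -> R) : (forall t, a <= t <= b -> derivable u t 1) ->
    {within `[a, b], continuous u}.
  by move=> du; apply: derivable_within_continuous => t; rewrite in_itv; exact: du.
have cf : {within `[a, b], continuous f}.
  apply: ch => t /andP[at_ _]; apply: derivableM => //.
  apply: ex_derive; apply: is_derive1_powR; exact: lt_le_trans at_.
have E := @integration_by_parts R F G f h a b ab cf
  (is_derive_derivable_oo_LRcontinuous ab Ff) _ _
  (is_derive_derivable_oo_LRcontinuous ab (fun t _ => Gh t)) _.
have -> : (\int[mu]_(t in `[a, b]) (g (x + 1) t)%:E =
    \int[mu]_(t in `[a, b]) (F t * h t)%:E)%E.
  by apply: eq_integral => t _; rewrite /g addrK.
rewrite E; first last.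
- by move=> t _; rewrite derive1E; exact: derive_val.
- by apply: ch => t _; have [] := hd t.
- move=> t; rewrite in_itv/= => /andP[at_ tb]; rewrite derive1E.
  by have /Ff[_ ->] : a <= t <= b by rewrite !ltW.
have -> : (\int[mu]_(t in `[a, b]) (f t * G t)%:E =
    (- x)%:E * \int[mu]_(t in `[a, b]) (g x t)%:E)%E.
  have cg : {within `[a, b], continuous (g x)}.
    apply: ch => t /andP[at_ _]; apply: derivableM; last by have [] := hd t.
    by apply: ex_derive; apply: is_derive1_powR; exact: lt_le_trans at_.
  rewrite -integralZl//; last first.
    by apply: continuous_compact_integrable => //; exact: segment_compact.
  by apply: eq_integral => t _; rewrite /f /G /g -EFinM; congr EFin; ring.
rewrite EFinN mulNe oppeK /F /G addeAC -EFinD.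
by congr (_%:E + _)%E; ring.
Qed.

Lemma powR_expRN_cvgy x : t `^ x * expR (- t) @[t --> +oo] --> (0 : R).
Proof.
have [k xk] : exists k : nat, x <= k%:R.
  by exists (Num.truncn x).+1; rewrite ltW// truncnS_gt.
have lim : (k.+1`!%:R * t^-1) @[t --> +oo] --> (0 : R).
  rewrite -[X in _ --> X](mulr0 (k.+1`!%:R : R)); apply: cvgMl_tmp.
  by apply/(@gtr0_cvgV0 _ _ _ _ id) => //; exact: nbhs_pinfty_gt.
apply: (squeeze_cvgr _ (cvg_cst 0) lim).
near=> t.
have t1 : 1 <= t by near: t; exact: nbhs_pinfty_ge.
have t0 : 0 < t by apply: lt_le_trans t1.
rewrite mulr_ge0 ?powR_ge0 ?expR_ge0//=.
apply: (@le_trans _ _ (t ^+ k * expR (- t))).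
  by rewrite ler_wpM2r ?expR_ge0// -powR_mulrn ?(ltW t0)// ler_powR.
rewrite expRN ler_pdivrMr ?expR_gt0//.
have kf : (k.+1`!%:R : R) != 0 by rewrite pnatr_eq0 -lt0n fact_gt0.
have -> : t ^+ k = k.+1`!%:R / t * (t ^+ k.+1 / k.+1`!%:R).
  by rewrite exprS; field; rewrite kf gt_eqF.
rewrite ler_wpM2l ?(divr_ge0 _ (ltW t0))//.
by apply: le_trans (expR_ge1Dxn k (ltW t0)); rewrite lerDr.
Unshelve. all: by end_near. Qed.

(** With [n.+2] the segment is nondegenerate already at [n = 0], as integration by parts
    requires. *)
Let J (n : nat) : set R := `[n.+2%:R^-1, n.+2%:R]%classic.

Lemma bigcup_itv_inv : \bigcup_n J n = `]0, +oo[%classic.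
Proof.
apply/seteqP; split=> t/=.
  move=> [n _]; rewrite !in_itv/= andbT => /andP[nt _].
  by rewrite bnd_simp in nt; apply: (lt_le_trans _ nt); rewrite invr_gt0.
rewrite !in_itv/= andbT => t0.
pose m := maxn (Num.truncn t) (Num.truncn t^-1).
exists m => //=; rewrite /J/= in_itv/=; apply/andP; split.
  rewrite invf_ple ?posrE// (le_trans (ltW (truncnS_gt _)))// ler_nat.
  by rewrite ltnW// !ltnS leq_maxr.
rewrite (le_trans (ltW (truncnS_gt _)))// ler_nat.
by rewrite ltnW// !ltnS leq_maxl.
Qed.

Lemma egamma_cvg x :
  (\int[mu]_(t in J n) (g x t)%:E)%E @[n --> \oo] -->
  egamma x.
Proof.
rewrite /egamma -bigcup_itv_inv; apply: ge0_nondecreasing_set_cvg_integral.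
- move=> n m nm; rewrite subsetEset; apply: subset_itv; rewrite bnd_simp.
    by rewrite lef_pV2 ?posrE// ler_nat !ltnS.
  by rewrite ler_nat !ltnS.
- by move=> n; exact: measurable_itv.
- by move=> n; exact: measurable_egamma_integrand.
- by move=> n t _; rewrite lee_fin gamma_integrand_ge0.
Qed.

Lemma egamma_ge0 x : (0 <= egamma x)%E.
Proof. by apply: integral_ge0 => t _; rewrite lee_fin gamma_integrand_ge0. Qed.

(** Integrate by parts on [J n] and let [n] grow. Both boundary terms vanish, the one near 0 because
    [x > 0]. *)
Lemma egammaD1 x : 0 < x -> egamma (x + 1) = (x%:E * egamma x)%E.
Proof.
move=> x0; pose a n : R := n.+2%:R^-1; pose b n : R := n.+2%:R.
have ab n : a n < b n.
  by rewrite /a /b (@lt_trans _ _ 1)// ?invf_lt1// ltr1n.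
have cy : b n @[n --> \oo] --> +oo.
  have := @cvgr_idn R; rewrite -(cvg_shiftS (fun n => n%:R : R)).
  by rewrite -(cvg_shiftS (fun n => n.+1%:R : R)).
have ca0 : a n @[n --> \oo] --> (0 : R)^'+.
  have : a n @[n --> \oo] --> (0 : R).
    by apply/(@gtr0_cvgV0 _ _ _ _ b) => //; exact: nearW.
  move=> a_0 A; rewrite /at_right /within/= => A0.
  have : \forall n \near \oo, 0 < a n -> A (a n).
    exact: (a_0 (fun u => 0 < u -> A u) A0).
  by apply: filterS => n; apply; rewrite /a invr_gt0.
have cb : (b n `^ x * expR (- b n))%:E @[n --> \oo] --> 0%E.
  apply/fine_cvgP; split; first exact: nearW.
  exact: (cvg_comp _ _ cy (@powR_expRN_cvgy x)).
have ca : (a n `^ x * expR (- a n))%:E @[n --> \oo] --> 0%E.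
  apply/fine_cvgP; split; first exact: nearW.
  have lim := cvg_comp _ _ ca0 (@powR_cvg0 R x x0).
  apply: (squeeze_cvgr _ (cvg_cst 0) lim).
  apply: nearW => n /=; rewrite mulr_ge0 ?powR_ge0 ?expR_ge0//= ler_piMr ?powR_ge0//.
  by rewrite -expR0 ler_expR oppr_le0 invr_ge0.
have L : (\int[mu]_(t in J n) (g (x + 1) t)%:E +
    (b n `^ x * expR (- b n))%:E)%E @[n --> \oo] --> egamma (x + 1).
  rewrite -[egamma _]adde0; apply: cvgeD cb; last exact: egamma_cvg.
  by rewrite fin_num_adde_defl.
have M : ((a n `^ x * expR (- a n))%:E +
    x%:E * \int[mu]_(t in J n) (g x t)%:E)%E @[n --> \oo] -->
    (x%:E * egamma x)%E.
  rewrite -[(x%:E * _)%E]add0e; apply: cvgeD => //.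
  by apply: cvgeZl => //; exact: egamma_cvg.
apply: (cvg_unique _ L) => //=; apply: cvg_trans M; apply: near_eq_cvg.
by apply: nearW => n; rewrite -gamma_integral_by_parts// /a invr_gt0.
Qed.

Lemma egamma1 : egamma 1 = 1%E.
Proof.
have -> : egamma 1 = (\int[mu]_(t in `[0%R, +oo[) (expR (- t))%:E)%E.
  rewrite -integral_itv_obnd_cbnd; last first.
    by apply/measurable_EFinP; apply: measurable_funTS; exact: measurableT_comp.
  by apply: eq_integral => t _; rewrite /g subrr powRr0 mul1r.
have D t : is_derive t 1 (fun t => - expR (- t)) (expR (- t)).
  by have /is_derive_eq := is_deriveN (is_derive_expRN t); apply; rewrite opprK.
rewrite (@ge0_continuous_FTC2y _ _ (fun t => - expR (- t)) _ 0)//.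
- by rewrite oppr0 expR0 EFinN oppeK add0e.
- by apply: derivable_within_continuous => t _; have [] := is_derive_expRN t.
- by rewrite -[X in _ --> X]oppr0; apply: cvgN; exact: cvgr_expR.
- have : {for 0, continuous (fun t : R => - expR (- t))}.
    by have [d _] := D 0; apply/differentiable_continuous/derivable1_diffP.
  exact: cvg_at_right_filter.
- by move=> t _; rewrite derive1E; have [_ ->] := D t.
Qed.

Lemma egamma_nat_lty (n : nat) : (egamma n.+1%:R < +oo)%E.
Proof.
elim: n => [|n IH]; first by rewrite egamma1 ltry.
rewrite -addn1 natrD egammaD1// lte_mul_pinfty ?lee_fin//.
Qed.

(** For [y >= 1] the integrand is at most the sum of those at two consecutive integers around [y]:
    the larger serves for [t >= 1], the smaller for [t < 1]. The functional equation then carries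
    finiteness from [x + 1] to [x]. *)
Lemma egamma_lty x : 0 < x -> (egamma x < +oo)%E.
Proof.
move=> x0.
suff H y : 1 <= y -> (egamma y < +oo)%E.
  have : (egamma (x + 1) < +oo)%E by rewrite H// lerDr ltW.
  rewrite egammaD1// => ex.
  rewrite ltNge leye_eq; apply/negP => /eqP E; move: ex.
  by rewrite E gt0_muley ?lte_fin// ltxx.
move=> y1; have [n [ny yn]] : exists n, n.+1%:R <= y /\ y <= n.+2%:R.
  have n1 : (0 < Num.truncn y)%N by rewrite truncn_gt0.
  exists (Num.truncn y).-1; rewrite prednK//.
  by rewrite truncn_le ?(le_trans _ y1)// ltW// truncnS_gt.
apply: (@le_lt_trans _ _ (egamma n.+1%:R + egamma n.+2%:R)%E); last first.
  by apply: lte_add_pinfty; exact: egamma_nat_lty.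
rewrite /egamma -ge0_integralD//=; first last.
- exact: measurable_egamma_integrand.
- by move=> t _; rewrite lee_fin gamma_integrand_ge0.
- exact: measurable_egamma_integrand.
- by move=> t _; rewrite lee_fin gamma_integrand_ge0.
apply: ge0_le_integral => //=.
- by move=> t _; rewrite lee_fin gamma_integrand_ge0.
- exact: measurable_egamma_integrand.
- by apply: emeasurable_funD; exact: measurable_egamma_integrand.
move=> t; rewrite /= in_itv/= andbT => t0.
rewrite -EFinD lee_fin /g -mulrDl ler_wpM2r ?expR_ge0//.
have [t1|t1] := leP 1 t.
  apply: (@le_trans _ _ (t `^ (n.+2%:R - 1))); last by rewrite lerDr powR_ge0.
  by apply: ler_powR => //; rewrite lerB.
apply: (@le_trans _ _ (t `^ (n.+1%:R - 1))); last by rewrite lerDl powR_ge0.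
by apply: ger_powR; rewrite ?t0 ?(ltW t1)// lerB.
Qed.

(** Otherwise the integrand would vanish almost everywhere, yet it is positive on [[1, 2]], of
    measure 1. *)
Lemma egamma_gt0 x : (0 < egamma x)%E.
Proof.
rewrite lt_def egamma_ge0 andbT; apply/negP => /eqP E.
have : (\int[mu]_(t in `]0%R, +oo[) `|(g x t)%:E| = 0)%E.
  rewrite -E; apply: eq_integral => t _.
  by rewrite gee0_abs// lee_fin gamma_integrand_ge0.
move/ae_eq_integral_abs => /(_ (measurable_itv _) (@measurable_egamma_integrand _ _)).
move=> [N [mN N0 DN]].
have : (mu `[1%R, 2%R]%classic <= mu N)%E.
  apply: le_measure; rewrite ?inE//; apply: subset_trans DN => t/=.
  rewrite in_itv/= => /andP[t1 _] /(_ _).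
  have t0 : 0 < t by apply: lt_le_trans t1.
  rewrite in_itv/= t0 => /(_ isT)[] /eqP; apply/negP.
  by rewrite gt_eqF// mulr_gt0 ?powR_gt0 ?expR_gt0.
by rewrite N0 lebesgue_measure_itv/= lte_fin ltr1n -EFinB lee_fin; lra.
Qed.

Lemma gamma_fun_gt0 x : 0 < x -> 0 < gamma_fun x.
Proof. by move=> x0; rewrite gamma_funE fine_gt0// egamma_gt0 egamma_lty. Qed.

Lemma gamma_funD1 x : 0 < x -> gamma_fun (x + 1) = x * gamma_fun x.
Proof.
move=> x0; rewrite !gamma_funE egammaD1// fineM//.
by rewrite ge0_fin_numE ?egamma_ge0 ?egamma_lty.
Qed.

Lemma gamma_funDn x n : 0 < x ->
  gamma_fun (x + n%:R) = \prod_(j < n) (x + j%:R) * gamma_fun x.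
Proof.
move=> x0; elim: n => [|n IH]; first by rewrite addr0 big_ord0 mul1r.
rewrite -natr1 addrA gamma_funD1; last by rewrite ltr_wpDr.
by rewrite IH mulrA big_ord_recr/= [X in X * _ = _]mulrC.
Qed.

End gamma_function.

(** * The negative binomial likelihood *)

Section nb_likelihood.
Context {R : realType}.
Implicit Types (nu p m K : R) (n : nat) (y : nat -> nat).

(** The derivative of [nb_rising] in [nu]. Grouped by [j], it is the sum of the numbers of
    observations larger than [j], divided by [nu + j]. *)
Definition nb_score n y nu : R :=
  \sum_(i < n) \sum_(j < y i) (nu + j%:R)^-1.

(** For [nu > 0], the logarithm of the product of the ratios
    [gamma_fun (nu + y i) / gamma_fun nu]. *)
Definition nb_rising n y nu : R :=
  \sum_(i < n) \sum_(j < y i) ln (nu + j%:R).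

Definition nb_total n y : R := \sum_(i < n) (y i)%:R.

Definition nb_log n y nu p : R :=
  nb_rising n y nu + n%:R * nu * ln p + nb_total n y * ln (1 - p).

Definition nb_const n y : R := \prod_(i < n) (gamma_fun ((y i)%:R + 1))^-1.

Lemma nb_const_gt0 n y : 0 < nb_const n y.
Proof.
by apply: prodr_gt0 => i _; rewrite invr_gt0 gamma_fun_gt0// ltr_wpDl.
Qed.

Lemma expR_sum_ln (k : nat) nu : 0 < nu ->
  \prod_(j < k) (nu + j%:R) = expR (\sum_(j < k) ln (nu + j%:R)).
Proof.
move=> nu0; rewrite expR_sum; apply: eq_bigr => j _.
by rewrite lnK// posrE ltr_wpDr.
Qed.

Lemma nb_pmfE nu p (k : nat) : 0 < nu -> 0 < p < 1 ->
  nb_pmf nu p k = (gamma_fun (k%:R + 1))^-1 *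
    expR (\sum_(j < k) ln (nu + j%:R) + nu * ln p + k%:R * ln (1 - p)).
Proof.
move=> nu0 /andP[p0 p1]; rewrite /nb_pmf lt_eqF// gamma_funDn// expR_sum_ln//.
have g0 : gamma_fun nu != 0 by rewrite gt_eqF// gamma_fun_gt0.
have gk : gamma_fun (k%:R + 1) != 0 :> R.
  by rewrite gt_eqF// gamma_fun_gt0// ltr_wpDl.
rewrite /powR gt_eqF// 2!expRD expRM_natl lnK ?posrE ?subr_gt0//.
by field; rewrite g0 gk.
Qed.

Lemma nb_likelihoodE n y nu p : 0 < nu -> 0 < p < 1 ->
  nb_likelihood n y nu p = nb_const n y * expR (nb_log n y nu p).
Proof.
move=> nu0 p01; rewrite /nb_likelihood.
under eq_bigr do rewrite nb_pmfE//.
rewrite big_split/=; congr (_ * _); rewrite -expR_sum; congr expR.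
rewrite !big_split/= /nb_log /nb_rising; congr (_ + _ + _).
  by rewrite sumr_const card_ord -mulrA mulr_natl.
by rewrite mulr_suml.
Qed.

Lemma nb_likelihood_p1 n y nu : 0 < nb_total n y -> nb_likelihood n y nu 1 = 0.
Proof.
move=> t0; apply/eqP; rewrite /nb_likelihood.
have [i yi] : exists i : 'I_n, (0 < y i)%N.
  apply/not_existsP => H; move: t0; rewrite /nb_total big1 ?ltxx// => i _.
  by have /negP := H i; rewrite lt0n negbK => /eqP ->.
by rewrite (bigD1 i)//= /nb_pmf eqxx gtn_eqF// mul0r.
Qed.

(** Gibbs' inequality for two-point laws: [ln x <= x - 1] is applied to each term, and the linear
    errors cancel because [p + (1 - p) = 1]. *)
Lemma nb_best_p nu p m : 0 < nu -> 0 < m -> 0 < p < 1 ->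
  nu * ln p + m * ln (1 - p) <=
  nu * ln (nu / (nu + m)) + m * ln (m / (nu + m)).
Proof.
move=> nu0 m0 /andP[p0 p1].
have nm : 0 < nu + m by rewrite addr_gt0.
have q0 : 0 < 1 - p by rewrite subr_gt0.
have H (a b : R) : 0 < a -> 0 < b -> a * ln b <= a * ln (a / (nu + m)) +
    (b * (nu + m) - a).
  move=> a0 b0.
  have : 0 < a / (nu + m) by rewrite divr_gt0.
  have -> : b * (nu + m) - a = a * (b / (a / (nu + m)) - 1).
    by field; rewrite !gt_eqF.
  move: (a / (nu + m)) => r r0.
  rewrite -lerBlDl -mulrBr -ln_div ?posrE// ler_pM2l//.
  have := @le_ln1Dx R (b / r - 1); rewrite [1 + _]addrC subrK; apply.
  by rewrite ltrBrDr addrC subrr divr_gt0.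
have := H nu p nu0 p0; have := H m (1 - p) m0 q0; lra.
Qed.

(** The log-likelihood at [p = nu / (nu + m)], without the term [nb_total n y * ln m], which is
    constant in [nu]. *)
Definition nb_profile n y m nu : R :=
  nb_rising n y nu + n%:R * (nu * (ln nu - ln (nu + m))) -
  nb_total n y * ln (nu + m).

Lemma nb_log_profile n y m nu : 0 < nu -> 0 < m ->
  nb_log n y nu (nu / (nu + m)) = nb_profile n y m nu + nb_total n y * ln m.
Proof.
move=> nu0 m0; have nm : 0 < nu + m by rewrite addr_gt0.
rewrite /nb_log.
have -> : 1 - nu / (nu + m) = m / (nu + m) by field; rewrite gt_eqF.
by rewrite /nb_profile !ln_div ?posrE//; ring.
Qed.

(** When [m] is the sample mean, the rational terms cancel:
    [1 - nu / (nu + m) - m / (nu + m) = 0]. *)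
Lemma is_derive_nb_profile n y m nu : 0 < nu -> 0 < m ->
  nb_total n y = n%:R * m ->
  is_derive nu 1 (nb_profile n y m)
    (nb_score n y nu - n%:R * (ln (nu + m) - ln nu)).
Proof.
move=> nu0 m0 tot; have nm : 0 < nu + m by rewrite addr_gt0.
have lnD c : 0 < nu + c -> is_derive nu 1 (fun x => ln (x + c)) (nu + c)^-1.
  move=> nuc; have := @is_derive_lnD R c nu; rewrite addrC => /(_ nuc).
  by congr is_derive; apply/funext => x; rewrite addrC.
have D1 : is_derive nu 1 (nb_rising n y) (nb_score n y nu).
  apply: (@is_derive_fsum _ n (fun i x => \sum_(j < y i) ln (x + j%:R))
    (fun i => \sum_(j < y i) (nu + j%:R)^-1)) => i _.
  apply: (@is_derive_fsum _ (y i) (fun j x => ln (x + j%:R))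
    (fun j => (nu + j%:R)^-1)) => j _.
  by apply: lnD; rewrite ltr_wpDr.
have D2 : is_derive nu 1 (fun x => ln x - ln (x + m)) (nu^-1 - (nu + m)^-1).
  exact: is_deriveB (is_derive1_ln nu0) (lnD _ nm).
have D3 := is_deriveZ n%:R (is_deriveM (is_derive_id nu 1) D2).
have D4 := is_deriveZ (nb_total n y) (lnD _ nm).
have /is_derive_eq := is_deriveB (is_deriveD D1 D3) D4; apply.
rewrite /GRing.scale/= tot. field.
by rewrite !gt_eqF.
Qed.

(** If [nu < K], the admissible pair [(K, K / (K + m))] does strictly better: first replace [p] by
    its optimum, then move along the increasing profile from [nu] to [K]. *)
Lemma nb_mle_ge n y K numax nu p : (0 < n)%N -> 0 < K -> K <= numax ->
  (forall nu, 0 < nu <= K ->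
    n%:R * (ln (nu + nb_total n y / n%:R) - ln nu) < nb_score n y nu) ->
  is_nb_mle numax n y nu p -> K <= nu.
Proof.
move=> n0 K0 Kmax score [/andP[nu0 numaxE] /andP[p0 p1] mle].
have nR : 0 < n%:R :> R by rewrite ltr0n.
set m := nb_total n y / n%:R in score.
have tot : nb_total n y = n%:R * m by rewrite /m mulrC divfK// gt_eqF.
(* If the mean were 0, all observations and hence the score would be 0, against the strict
   inequality at [K]. *)
have m0 : 0 < m.
  have : 0 <= m by rewrite divr_ge0// sumr_ge0.
  rewrite le_eqVlt => /predU1P[m0|//].
  have : nb_score n y K <= 0.
    rewrite /nb_score big1// => i _.
    have : nb_total n y == 0 by rewrite tot -m0 mulr0.
    rewrite psumr_eq0// => /allP/(_ i); rewrite mem_index_enum => /(_ isT)/=.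
    by rewrite pnatr_eq0 => /eqP ->; rewrite big_ord0.
  have := score K; rewrite K0 lexx -m0 addr0 subrr mulr0 => /(_ isT) h1 h2.
  by have := lt_le_trans h1 h2; rewrite ltxx.
have t0 : 0 < nb_total n y by rewrite tot mulr_gt0.
have ratio x : 0 < x -> 0 < x / (x + m) < 1.
  move=> x0; rewrite divr_gt0 ?addr_gt0//= ltr_pdivrMr ?addr_gt0//.
  by rewrite mul1r ltrDl.
rewrite leNgt; apply/negP => nuK.
have /andP[pK0 pK1] := ratio _ K0.
have := mle K (K / (K + m)); rewrite K0 Kmax pK0 (ltW pK1) => /(_ isT isT).
rewrite leNgt => /negP; apply.
rewrite (nb_likelihoodE _ _ K0) ?pK0//.
(* At [p = 1] the likelihood is 0, because some observation is positive. *)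
move: p1; rewrite le_eqVlt => /predU1P[->|p1].
  by rewrite nb_likelihood_p1// mulr_gt0 ?nb_const_gt0 ?expR_gt0.
rewrite nb_likelihoodE ?p0// ltr_pM2l ?nb_const_gt0// ltr_expR.
apply: (@le_lt_trans _ _ (nb_log n y nu (nu / (nu + m)))).
  have := @nb_best_p nu p m nu0 m0; rewrite p0 p1 => /(_ isT).
  rewrite -(ler_pM2l nR) /nb_log tot.
  have -> : 1 - nu / (nu + m) = m / (nu + m).
    by field; rewrite gt_eqF// addr_gt0.
  lra.
rewrite !nb_log_profile// ltrD2r.
apply: (is_derive_gt0_lt nuK) => x /andP[nux xK].
  by apply: is_derive_nb_profile => //; exact: lt_le_trans nux.
by rewrite subr_gt0 score// (lt_trans nu0)//= ltW.
Qed.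

Lemma sum_ord_indicator_le (a : nat -> R) (k J : nat) :
  (forall j, 0 <= a j) ->
  \sum_(j < J) (j < k)%N%:R * a j <= \sum_(j < k) a j.
Proof.
move=> a0.
rewrite (big_ord_widen _ (fun j => (j < k)%N%:R * a j) (leq_addr k J)).
rewrite (big_ord_widen _ a (leq_addl J k)).
rewrite big_mkcond [leRHS]big_mkcond/=; apply: ler_sum => j _.
by case: ifP; case: ifP; rewrite ?mul1r ?mul0r.
Qed.

(** Exchange the two sums and drop the indices [j >= J]. Upper bounds on the empirical distribution
    function become lower bounds on the tails. *)
Lemma nb_score_ge n y nu J (F : nat -> R) : 0 < nu ->
  (forall j, (j < J)%N -> \sum_(i < n) (y i <= j)%N%:R <= n%:R * F j) ->
  n%:R * \sum_(j < J) (1 - F j) / (nu + j%:R) <= nb_score n y nu.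
Proof.
move=> nu0 hF.
apply: (@le_trans _ _
  (\sum_(i < n) \sum_(j < J) (j < y i)%N%:R * (nu + j%:R)^-1)); last first.
  apply: ler_sum => i _.
  apply: (sum_ord_indicator_le (a := fun j => (nu + j%:R)^-1)) => j.
  by rewrite invr_ge0 ltW// ltr_wpDr.
rewrite exchange_big/= mulr_sumr; apply: ler_sum => j _.
rewrite -mulr_suml mulrA ler_wpM2r//; first by rewrite invr_ge0 ltW// ltr_wpDr.
have -> : \sum_(i < n) (j < y i)%N%:R = n%:R - \sum_(i < n) (y i <= j)%N%:R :> R.
  rewrite -[X in X%:R - _](card_ord n) -sum1_card natr_sum -sumrB.
  by apply: eq_bigr => i _; rewrite ltnNge; case: (y i <= j)%N; rewrite ?subrr ?subr0.
by rewrite mulrBr mulr1 lerB// hF.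
Qed.

(** The deterministic half of the proof: finitely many bounds on the sample, all from above, so that
    a one-sided law of large numbers for nonnegative variables suffices. *)
Lemma nb_mle_ge_of_pois (lambda K : R) : 0 < lambda -> 0 < K ->
  exists (J : nat) (e : R), 0 < e /\ forall n y numax nu p, (0 < n)%N ->
    (forall j, (j < J)%N ->
      \sum_(i < n) (y i <= j)%N%:R <= n%:R * (pois_cdf lambda j + e)) ->
    nb_total n y <= n%:R * (lambda + e) ->
    K <= numax -> is_nb_mle numax n y nu p -> K <= nu.
Proof.
move=> l0 K0; have [J [e [e0 H]]] := pois_score_gt0 l0 K0.
exists J.+1, e; split => // n y numax nu p n0 hj ht hK.
have nR : 0 < n%:R :> R by rewrite ltr0n.
apply: nb_mle_ge => // x xK; have /andP[x0 _] := xK.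
apply: lt_le_trans (nb_score_ge x0 hj); rewrite ltr_pM2l//.
under eq_bigr do rewrite opprD addrA.
apply: H => //; first by rewrite divr_ge0// sumr_ge0.
by rewrite ler_pdivrMr// mulrC.
Qed.

End nb_likelihood.

(** * The strong law of large numbers *)

Lemma ex_sqrtn (n : nat) : exists k, (k ^ 2 <= n <= k.+1 ^ 2)%N.
Proof.
elim: n => [|n [k /andP[kn nk]]]; first by exists 0%N.
move: nk; rewrite leq_eqVlt => /predU1P[->|nk]; last first.
  by exists k; rewrite nk (leq_trans kn).
by exists k.+1; rewrite leqnSn ltn_sqr ltnSn.
Qed.

Lemma sum_invr_sqr_lty (R : realType) (C : R) : 0 <= C ->
  (\sum_(k <oo) (C / (k.+1 ^ 2)%:R)%:E < +oo)%E.
Proof.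
move=> C0; apply: (@le_lt_trans _ _ (2 * C)%:E); last exact: ltry.
apply: lime_le.
  apply: is_cvg_nneseries => k _ _.
  by rewrite lee_fin divr_ge0.
apply: nearW => n; rewrite sumEFin lee_fin.
(* The induction rests on [1 / k ^ 2 <= 2 / k - 2 / (k + 1)] for [k >= 1]. *)
apply: (@le_trans _ _ (2 * C - 2 * C / n.+1%:R)); last first.
  by rewrite lerBlDr lerDl divr_ge0// mulr_ge0.
rewrite big_mkord; elim: n => [|n IH].
  by rewrite big_ord0 divr1 subrr.
rewrite big_ord_recr/= -lerBrDr; apply: le_trans IH _.
have n1 : 0 < n.+1%:R :> R by [].
have n2 : n.+2%:R = n.+1%:R + 1 :> R by rewrite natr1.
rewrite n2 natrX -subr_ge0.
have -> : 2 * C - 2 * C / (n.+1%:R + 1) - C / n.+1%:R ^+ 2 -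
    (2 * C - 2 * C / n.+1%:R) =
    C * (n.+1%:R - 1) / (n.+1%:R ^+ 2 * (n.+1%:R + 1)) :> R.
  by field; rewrite !gt_eqF// addr_gt0.
rewrite divr_ge0 ?mulr_ge0 ?exprn_ge0// subr_ge0 ler1n//.
Qed.

Section strong_law.
Context {R : realType} {d : measure_display} {T : measurableType d}.
Variables (P : probability T R) (X : nat -> T -> R) (m M : R).
(** Pairwise uncorrelated nonnegative variables with common first two moments, stated through
    integrals that make sense before integrability is known. *)
Hypothesis mX : forall i, measurable_fun setT (X i).
Hypothesis X0 : forall i w, 0 <= X i w.
Hypothesis EX : forall i, (\int[P]_w (X i w)%:E = m%:E)%E.
Hypothesis EXX : forall i, (\int[P]_w (X i w * X i w)%:E = M%:E)%E.
Hypothesis EXY : forall i j, i <> j ->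
  (\int[P]_w (X i w * X j w)%:E = (m * m)%:E)%E.

Let S n w := \sum_(i < n) X i w.

Let mS n : measurable_fun setT (S n).
Proof. by apply: measurable_sum => i; exact: mX. Qed.

Let S0 n w : 0 <= S n w.
Proof. by rewrite sumr_ge0. Qed.

Let m0 : 0 <= m.
Proof. by rewrite -lee_fin -(EX 0); apply: integral_ge0 => w _; rewrite lee_fin. Qed.

Lemma integral_partial_sum n : (\int[P]_w (S n w)%:E = (n%:R * m)%:E)%E.
Proof.
rewrite /S; under eq_integral do rewrite -sumEFin.
rewrite ge0_integral_sum//; last 2 first.
- by move=> i; apply/measurable_EFinP.
- by move=> i w _; rewrite lee_fin.
under eq_bigr do rewrite EX.
by rewrite sumEFin sumr_const card_ord mulr_natl.
Qed.

Lemma integral_partial_sum_sqr n :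
  (\int[P]_w (S n w * S n w)%:E = (n%:R * (M - m * m) + (n%:R * m) ^+ 2)%:E)%E.
Proof.
have E w : (S n w * S n w)%:E =
    (\sum_(i < n) \sum_(j < n) (X i w * X j w)%:E)%E.
  rewrite /S mulr_suml -sumEFin; apply: eq_bigr => i _.
  by rewrite mulr_sumr -sumEFin.
under eq_integral do rewrite E.
have mXX (i j : nat) : measurable_fun setT (fun w => (X i w * X j w)%:E).
  by apply/measurable_EFinP; exact: measurable_funM.
have XX0 (i j : nat) w : (0 <= (X i w * X j w)%:E)%E.
  by rewrite lee_fin mulr_ge0.
rewrite ge0_integral_sum//; last 2 first.
- by move=> i; apply: emeasurable_sum.
- by move=> i w _; apply: sume_ge0.
transitivity (\sum_(i < n) ((M - m * m) + n%:R * (m * m))%:E)%E; last first.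
  by rewrite sumEFin sumr_const card_ord -mulr_natl; congr EFin; ring.
apply: eq_bigr => i _; rewrite ge0_integral_sum//.
rewrite (bigD1 i)//= EXX.
rewrite (eq_bigr (fun=> (m * m)%:E)); last first.
  by move=> j ji; apply: EXY => /val_inj ij; rewrite ij eqxx in ji.
rewrite sumEFin -EFinD; congr EFin.
have : \sum_(j < n) (m * m) = n%:R * (m * m).
  by rewrite sumr_const card_ord mulr_natl.
rewrite (bigD1 i)//= => <-; ring.
Qed.

(** Chebyshev's inequality: the variance is [n%:R * (M - m * m)], the deviation [n%:R * e]. *)
Lemma partial_sum_tail n e : (0 < n)%N -> 0 < e ->
  (P [set w | (n%:R * (m + e) <= S n w)%R] <= ((M - m * m) / (e ^+ 2) / n%:R)%:E)%E.
Proof.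
move=> n0 e0.
have nR : 0 < n%:R :> R by rewrite ltr0n.
pose c := n%:R * m; have c0 : 0 <= c by rewrite mulr_ge0.
have msq : measurable_fun setT (fun w => ((S n w - c) ^+ 2)%:E).
  apply/measurable_EFinP; apply: measurable_funX.
  exact: measurable_funB.
have var : (\int[P]_w ((S n w - c) ^+ 2)%:E = (n%:R * (M - m * m))%:E)%E.
  (* With [2 c S] moved to the left all integrands are nonnegative, so that no
     integrability is needed. *)
  have : (\int[P]_w ((S n w - c) ^+ 2 + 2 * c * S n w)%:E =
          \int[P]_w (S n w * S n w + c ^+ 2)%:E)%E.
    by apply: eq_integral => w _; congr EFin; ring.
  have c20 : 0 <= 2 * c by rewrite mulr_ge0.
  have mcS : measurable_fun setT (fun w => (2 * c * S n w)%:E).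
    by apply/measurable_EFinP; exact: measurable_funM.
  have mSS : measurable_fun setT (fun w => (S n w * S n w)%:E).
    by apply/measurable_EFinP; exact: measurable_funM.
  under eq_integral do rewrite EFinD.
  rewrite ge0_integralD//; last 2 first.
  - by move=> w _; rewrite lee_fin sqr_ge0.
  - by move=> w _; rewrite lee_fin mulr_ge0.
  under [X in (_ + X = _)%E]eq_integral do rewrite EFinM.
  rewrite ge0_integralZl_EFin//; last 2 first.
  - by move=> w _; rewrite lee_fin.
  - by apply/measurable_EFinP.
  rewrite integral_partial_sum.
  under [X in (_ = X)%E]eq_integral do rewrite EFinD.
  rewrite [in X in (_ = X)%E]ge0_integralD//; last 2 first.
  - by move=> w _; rewrite lee_fin mulr_ge0.
  - by move=> w _; rewrite lee_fin sqr_ge0.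
  rewrite integral_partial_sum_sqr (integral_cst P measurableT).
  rewrite (_ : (_ * P setT = (c ^+ 2)%:E)%E); last first.
    by rewrite probability_setT mule1.
  rewrite -EFinM -EFinD.
  move=> /(congr1 (fun z => (z - (2 * c * (n%:R * m))%:E)%E)).
  rewrite addeK// => ->; rewrite -EFinB; congr EFin; rewrite /c; ring.
have mA : measurable [set w | n%:R * (m + e) <= S n w].
  rewrite -[X in measurable X]setTI; exact: measurable_fun_le.
have -> : ((M - m * m) / e ^+ 2 / n%:R) = (n%:R * (M - m * m)) / (n%:R * e) ^+ 2.
  by field; rewrite !gt_eqF.
have ne0 : 0 < (n%:R * e) ^+ 2 by rewrite exprn_gt0 ?mulr_gt0.
rewrite EFinM -var [leRHS]muleC lee_pdivlMl//.
rewrite -(@integral_cst _ _ _ P)//.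
apply: (@le_trans _ _ (\int[P]_(w in [set w | (n%:R * (m + e) <= S n w)%R])
   ((S n w - c) ^+ 2)%:E)%E); last first.
  apply: ge0_subset_integral => //.
  by move=> w _; rewrite lee_fin sqr_ge0.
apply: ge0_le_integral => //=.
- by move=> w _; rewrite lee_fin ltW.
- exact: measurable_funTS.
- move=> w /= h; rewrite lee_fin lerXn2r ?nnegrE ?mulr_ge0 ?(ltW e0) ?(ltW nR)//.
    rewrite subr_ge0; apply: le_trans h; rewrite ler_pM2l// lerDl ltW//.
  by rewrite lerBrDl -mulrDr.
Qed.


(** Read off from the tail bound at [n = 1], [e = 1], which dominates a probability. *)
Let variance_ge0 : 0 <= M - m * m.
Proof.
have := integral_partial_sum_sqr 1; have := @partial_sum_tail 1 1 isT ltr01.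
by rewrite expr1n !divr1 => /(le_trans (measure_ge0 _ _)); rewrite lee_fin.
Qed.

(** The tail bounds, of order [1 / n], are summable along the squares, so the Borel-Cantelli lemma
    applies. *)
Lemma partial_sum_squares_ae e : 0 < e ->
  {ae P, forall w, \forall k \near \oo,
    S (k.+1 ^ 2)%N w < (k.+1 ^ 2)%N%:R * (m + e)}.
Proof.
move=> e0.
pose B k := [set w | (k.+1 ^ 2)%N%:R * (m + e) <= S (k.+1 ^ 2)%N w].
have mB k : measurable (B k).
  rewrite /B -[X in measurable X]setTI; exact: measurable_fun_le.
exists (lim_sup_set B); split.
- by apply: bigcap_measurable => // n _; exact: bigcup_measurable.
- apply: lim_sup_set_cvg0 => //.
  have C0 : 0 <= (M - m * m) / e ^+ 2 by rewrite divr_ge0// exprn_ge0// ltW.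
  apply: le_lt_trans (sum_invr_sqr_lty C0).
  apply: lee_nneseries => [k _ _|k _]; first exact: measure_ge0.
  by apply: partial_sum_tail => //; rewrite expn_gt0.
move=> w /= nw n _; apply: contrapT => nB; apply: nw.
exists n => //= k nk; rewrite ltNge; apply/negP => h; apply: nB.
by exists k.
Qed.

(* Between consecutive squares, [S n] is bounded by its value at the next one. *)
Lemma partial_sum_ae e : 0 < e ->
  {ae P, forall w, \forall n \near \oo, \sum_(i < n) X i w <= n%:R * (m + e)}.
Proof.
move=> e0; have e20 : 0 < e / 2 by rewrite divr_gt0.
apply: filterS (partial_sum_squares_ae e20) => w [N _ HN].
(* Passing from [k.+1 ^ 2] to [k ^ 2] requires [(2 * k + 1) * (m + e / 2) <= k ^ 2 * (e / 2)]. As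
   [2 * k + 1 <= 3 * k] for [k >= 1], it is enough that [k >= q]. *)
pose q := 6 * (m + e / 2) / e.
have q0 : 0 <= q by rewrite divr_ge0 ?(ltW e0)// mulr_ge0// addr_ge0 ?(ltW e20).
pose N1 := maxn (maxn N 1) (Num.truncn q).+1.
exists (N1.+1 ^ 2)%N => //= n; rewrite /= => nN.
have [k /andP[kn nk]] := ex_sqrtn n.
have kN1 : (N1 <= k)%N.
  by rewrite -ltnS -(ltn_sqr N1) (leq_trans _ nk)// (leq_trans _ nN)// ltn_sqr.
have Nk : (N <= k)%N by rewrite (leq_trans _ kN1)// /N1 -maxnA leq_maxl.
have k1 : (1 <= k)%N by rewrite (leq_trans _ kN1)// /N1 leq_max leq_maxr.
have qk : q <= k%:R.
  rewrite (le_trans (ltW (truncnS_gt q)))// ler_nat (leq_trans _ kN1)//.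
  by rewrite /N1 leq_maxr.
apply: (@le_trans _ _ (S (k.+1 ^ 2)%N w)).
  rewrite /S (big_ord_widen _ (fun i => X i w) nk) big_mkcond/=.
  by apply: ler_sum => i _; case: ifP.
apply: (le_trans (ltW (HN k Nk))).
apply: (@le_trans _ _ ((k ^ 2)%N%:R * (m + e))); last first.
  by rewrite ler_wpM2r ?ler_nat// addr_ge0// ltW.
rewrite !natrX -natr1.
have kR : 1 <= k%:R :> R by rewrite ler1n.
have : 6 * (m + e / 2) <= k%:R * e by move: qk; rewrite /q ler_pdivrMr.
have me : 0 <= m + e / 2 by rewrite addr_ge0// ltW.
move=> h.
have h1 : 3 * k%:R * (m + e / 2) <= k%:R * (k%:R * (e / 2)).
  by rewrite mulrAC mulrC ler_pM2l ?(lt_le_trans ltr01)//; lra.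
have h2 : (2 * k%:R + 1) * (m + e / 2) <= 3 * k%:R * (m + e / 2).
  by rewrite ler_wpM2r//; lra.
lra.
Qed.

End strong_law.

(** * The law of large numbers for functions of independent discrete variables *)

Section nat_random_variable.
Context {R : realType} {d : measure_display} {T : measurableType d}.
Variable P : probability T R.

Lemma measurable_fun_nat (Y : {RV P >-> nat}) (f : nat -> R) :
  measurable_fun setT (fun w => f (Y w)).
Proof. exact: measurableT_comp. Qed.

(** A general domain [D] permits integration over an event fixing the value of another variable, as
    the mixed moments require. *)
Lemma integral_nat_rv (D : set T) (Y : {RV P >-> nat}) (f : nat -> R) :
  measurable D -> (forall k, 0 <= f k) ->
  (\int[P]_(w in D) (f (Y w))%:E =
   \sum_(k <oo) (f k)%:E * P (D `&` Y @^-1` [set k]))%E.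
Proof.
move=> mD f0.
have mF k : measurable (D `&` Y @^-1` [set k]).
  by apply: measurableI => //; rewrite -[X in measurable X]setTI; exact: measurable_funP.
have {1}-> : D = \bigcup_k (D `&` Y @^-1` [set k]).
  apply/seteqP; split=> w; last by move=> [k _ []].
  by move=> Dw; exists (Y w).
rewrite ge0_integral_bigcup//=; first last.
- by move=> i j _ _ [w [[_ <-] [_ <-]]].
- by move=> w _; rewrite lee_fin.
- by apply: measurable_funTS; apply/measurable_EFinP; exact: measurable_fun_nat.
apply: eq_eseriesr => k _.
rewrite -(@integral_cst _ _ _ P)//.
by apply: eq_integral => w; rewrite inE/= => -[_ ->].
Qed.

Lemma mutually_independent_pair (Y : nat -> {RV P >-> nat}) (i j a b : nat) :
  mutually_independent Y -> i <> j ->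
  P (Y i @^-1` [set a] `&` Y j @^-1` [set b]) =
  (P (Y i @^-1` [set a]) * P (Y j @^-1` [set b]))%E.
Proof.
move=> indep ij.
pose A k : set nat := if k == i then [set a] else [set b].
have := indep [fset i; j]%fset A (fun _ _ => I).
have Ai : A i = [set a] by rewrite /A eqxx.
have Aj : A j = [set b] by rewrite /A; case: eqP => // ji; case: ij.
rewrite big_fsetU1/=; last by rewrite inE; apply/eqP.
rewrite big_seq_fset1 Ai Aj => <-; congr (P _).
apply/seteqP; split=> w /=.
  move=> [wi wj] k /=; rewrite !inE => /orP[] /eqP ->; first by rewrite Ai.
  by rewrite Aj.
move=> h; split.
  by have := h i; rewrite /= Ai !inE eqxx; apply.
by have := h j; rewrite /= Aj !inE eqxx orbT; apply.
Qed.

Variables (Y : nat -> {RV P >-> nat}) (q : nat -> R).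
Hypothesis indep : mutually_independent Y.
Hypothesis Yq : forall i k, P (Y i @^-1` [set k]) = (q k)%:E.

Lemma nat_rv_lln (h : nat -> R) (m M e : R) : (forall k, 0 <= h k) ->
  (\sum_(k <oo) (h k * q k)%:E = m%:E)%E ->
  (\sum_(k <oo) (h k * h k * q k)%:E = M%:E)%E -> 0 < e ->
  {ae P, forall w, \forall n \near \oo,
     \sum_(i < n) h (Y i w) <= n%:R * (m + e)}.
Proof.
move=> h0 hm hM e0.
have q0 k : 0 <= q k by rewrite -lee_fin -(Yq 0) measure_ge0.
have EY (f : nat -> R) i : (forall k, 0 <= f k) ->
    (\int[P]_w (f (Y i w))%:E = \sum_(k <oo) (f k * q k)%:E)%E.
  move=> f0; rewrite integral_nat_rv//; apply: eq_eseriesr => k _.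
  by rewrite setTI EFinM Yq.
apply: (@partial_sum_ae _ _ _ P (fun i w => h (Y i w)) m M) => //.
- by move=> i; exact: measurable_fun_nat.
- by move=> i; rewrite EY.
- by move=> i; rewrite (EY (fun k => h k * h k))// => k; rewrite mulr_ge0.
move=> i j ij.
have mk k : measurable (Y i @^-1` [set k]).
  by rewrite -[X in measurable X]setTI; exact: measurable_funP.
(* The mixed moment is split by the value [k] of [Y i]: on each piece [h k] factors out, and
   independence of the pair yields [q k] times the mean of [h (Y j)]. *)
have setTE : setT = \bigcup_k (Y i @^-1` [set k]).
  by apply/seteqP; split=> // w _; exists (Y i w).
rewrite setTE ge0_integral_bigcup//=; first last.
- by move=> a b _ _ [w [<- <-]].
- by move=> w _; rewrite lee_fin mulr_ge0.
- apply: measurable_funTS; apply/measurable_EFinP.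
  by apply: measurable_funM; exact: measurable_fun_nat.
transitivity (\sum_(k <oo) (m%:E * (h k * q k)%:E))%E; last first.
  by rewrite nneseriesZl ?hm// => k _; rewrite lee_fin mulr_ge0.
apply: eq_eseriesr => k _.
transitivity (\int[P]_(w in Y i @^-1` [set k]) ((h k)%:E * (h (Y j w))%:E))%E.
  by apply: eq_integral => w; rewrite inE/= => ->; rewrite EFinM.
rewrite ge0_integralZl_EFin//; last 2 first.
- by move=> w _; rewrite lee_fin.
- by apply/measurable_EFinP; apply: measurable_funTS; exact: measurable_fun_nat.
rewrite integral_nat_rv//.
under eq_eseriesr do rewrite mutually_independent_pair// !Yq -EFinM mulrCA EFinM.
rewrite nneseriesZl ?hm; last by move=> l _; rewrite lee_fin mulr_ge0.
by rewrite -!EFinM; congr EFin; ring.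
Qed.

End nat_random_variable.

(** * Moments of the Poisson law *)

Section poisson_moments.
Context {R : realType}.
Implicit Types (l : R).

Lemma sum_pois l : (\sum_(k <oo) (pois l k)%:E = 1)%E.
Proof.
apply/cvg_lim => //; rewrite -cvg_shiftS.
have -> : (fun n => \sum_(0 <= k < n.+1) (pois l k)%:E)%E =
          EFin \o pois_cdf l.
  by apply/funext => n; rewrite sumEFin big_mkord.
by apply/fine_cvgP; split; [exact: nearW|exact: cvg_pois_cdf].
Qed.

(** The Stein-Chen identity, from [poisS] and a shift of the index. Taking [f] constant gives the
    mean, [f] the identity the second moment. *)
Lemma sum_pois_stein l (f : nat -> R) : 0 <= l -> (forall k, 0 <= f k) ->
  (\sum_(k <oo) (k%:R * f k * pois l k)%:E =
   l%:E * \sum_(k <oo) (f k.+1 * pois l k)%:E)%E.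
Proof.
move=> l0 f0.
have kf0 k : (0 <= (k%:R * f k * pois l k)%:E)%E.
  by rewrite lee_fin mulr_ge0 ?pois_ge0// mulr_ge0.
rewrite nneseries_recl// !mul0r add0e -(nneseries_addn 1)//.
rewrite -nneseriesZl => [|k _]; last by rewrite lee_fin mulr_ge0// pois_ge0.
apply: eq_eseriesr => k _; rewrite addn1 -EFinM; congr EFin.
by rewrite mulrAC poisS; ring.
Qed.

Lemma sum_pois_id l : 0 <= l -> (\sum_(k <oo) (k%:R * pois l k)%:E = l%:E)%E.
Proof.
move=> l0; have := @sum_pois_stein l (fun=> 1) l0 (fun=> ler01).
under eq_eseriesr do rewrite mulr1.
move=> ->; under eq_eseriesr do rewrite mul1r.
by rewrite sum_pois mule1.
Qed.

Lemma sum_pois_sqr l : 0 <= l ->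
  (\sum_(k <oo) (k%:R * k%:R * pois l k)%:E = (l * (l + 1))%:E)%E.
Proof.
move=> l0; rewrite (@sum_pois_stein l (fun k => k%:R))//.
under eq_eseriesr do rewrite -natr1 mulrDl mul1r EFinD.
rewrite nneseriesD => [|k _ _|k _ _]; last 2 first.
- by rewrite lee_fin mulr_ge0// pois_ge0.
- by rewrite lee_fin pois_ge0.
by rewrite sum_pois_id// sum_pois.
Qed.

Lemma sum_pois_le l j : 0 <= l ->
  (\sum_(k <oo) ((k <= j)%N%:R * pois l k)%:E = (pois_cdf l j)%:E)%E.
Proof.
move=> l0.
rewrite (@nneseries_split _ _ 0 j.+1)//=; last first.
  by move=> k _; rewrite lee_fin mulr_ge0// pois_ge0.
rewrite add0n [X in (_ + X)%E]eseries0 ?adde0; last first.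
  by move=> k jk _; rewrite leqNgt jk mul0r.
rewrite sumEFin big_mkord /pois_cdf; congr EFin; apply: eq_bigr => k _.
by rewrite -ltnS ltn_ord mul1r.
Qed.

End poisson_moments.

(** * Almost sure divergence of the estimate of [nu] *)

(* [Y i] is the observation of index [i + 1]. *)
Theorem theorem3p5 (R : realType) (d : measure_display) (T : measurableType d)
    (P : probability T R) (lambda : R) (Y : nat -> {RV P >-> nat})
    (numax : nat -> R) (nuhat phat : nat -> T -> R) :
  0 < lambda ->
  mutually_independent Y ->
  (forall i k, distribution P (Y i) [set k] = (poisson_pmf lambda k)%:E) ->
  (forall n, (0 < n)%N -> 0 < numax n) ->
  numax n @[n --> \oo] --> +oo ->
  (forall n w, (0 < n)%N ->
     is_nb_mle (numax n) n (fun i => Y i w) (nuhat n w) (phat n w)) ->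
  {ae P, forall w, nuhat n w @[n --> \oo] --> +oo}.
Proof.
move=> l0 indep distY _ numaxy mle.
have l00 := ltW l0.
have Yq i k : P (Y i @^-1` [set k]) = (pois lambda k)%:E.
  by rewrite /pois; have := distY i k; rewrite /poisson_pmf l0.
(* Integer thresholds suffice, and countably many almost sure events hold simultaneously. *)
have H (K : nat) :
    {ae P, forall w, \forall n \near \oo, K.+1%:R <= nuhat n w}.
  have [J [e [e0 HJ]]] := nb_mle_ge_of_pois l0 (ltr0Sn R K).
  have := @nat_rv_lln _ _ _ P Y (pois lambda) indep Yq (fun k => k%:R) _ _ e
    (fun=> ler0n _ _) (sum_pois_id l00) (sum_pois_sqr l00) e0.
  have : {ae P, forall w, forall j, \forall n \near \oo,
      \sum_(i < n) (Y i w <= j)%N%:R <= n%:R * (pois_cdf lambda j + e)}.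
    apply: ae_foralln => j.
    apply: (@nat_rv_lln _ _ _ P Y (pois lambda) indep Yq
      (fun k => (k <= j)%N%:R) _ (pois_cdf lambda j)) => //.
      exact: sum_pois_le.
    (* An indicator equals its square, so its second moment is again [pois_cdf lambda j]. *)
    under eq_eseriesr do rewrite -natrM mulnb andbb.
    exact: sum_pois_le.
  apply: filterS2 => w Hcdf Htot.
  (* Only finitely many [j] are involved, so one rank of [n] serves them all. *)
  have Hj : \forall n \near \oo, forall j : 'I_J,
      \sum_(i < n) (Y i w <= j)%N%:R <= n%:R * (pois_cdf lambda j + e).
    exact: filter_forall.
  near=> n.
  have n0 : (0 < n)%N by near: n; exact: nbhs_infty_gt.
  apply: (HJ n (fun i => Y i w) (numax n) _ (phat n w)) => //.
  - by move=> j jJ; apply: (near Hj n _ (Ordinal jJ)).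
  - by near: n.
  - by near: n; move/cvgryPge: numaxy; exact.
  - exact: mle.
have := ae_foralln H; apply: filterS => w Hw.
apply/cvgryPge => A; near=> n.
apply: (@le_trans _ _ (Num.truncn A).+1%:R); first exact: ltW (truncnS_gt _).
by near: n; exact: Hw.
Unshelve. all: by end_near. Qed.
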